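(* Let $(E,\|\cdot\|)$ be a Banach space, let $X$ be a Radon random vector on a probability space $(\Omega,\mathcal A,\mathbb P)$ with values in $E$ and distribution $P$, let $r\in(0,+\infty)$ with $\int_E\|x\|^r\,dP(x)<+\infty$, and let $n\ge 1$. Let $a=(a_1,\ldots,a_n)\in E^n$ be a local minimum of the $L^r$-distortion function $G_{r,n}^P$ (with respect to the product topology on $E^n$) such that, for every $i\in\{1,\ldots,n\}$, $a_i$ is a non-isolated point of $\operatorname{supp}(P)$. (a) The components $a_1,\ldots,a_n$ are pairwise distinct. Moreover, if $r\ge 1$, then, writing $\Gamma=\{a_1,\ldots,a_n\}$, for every $i\in\{1,\ldots,n\}$ and every Borel set $C\subset E$ with $W_{a_i}(\Gamma)\subset C\subset V_{a_i}(\Gamma)$, one has \[ a_i\in\operatorname{argmin}_{y\in E} G_{r,1}^{P(\cdot\mid C)}(y), \] equivalently $\{a_i\}$ is an $L^r$-optimal $1$-quantizer for $P(\cdot\mid C)$. (b) Let $r\ge 1$. Assume that for every $b\in E$ the norm is Gâteaux differentiable at $b-x$ for $P(dx)$-almost every $x\in E\setminus\{b\}$, and, when $r=1$, that $P(\{a_i\})=0$ for every $i$. Then $\Gamma=\{a_1,\ldots,a_n\}$ is an $L^r$-stationary $n$-quantizer for $P$. If, in addition, $E$ is strictly convex, then $\Gamma$ is admissible for $P$.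
   Context: $\operatorname{supp}(P)$ denotes the (topological) support of $P$. For a nonempty finite set $\Gamma\subset E$ and $x\in E$, $d(x,\Gamma)=\min_{b\in\Gamma}\|x-b\|$. The $L^r$-distortion function of level $n$ for a Borel probability $Q$ on $E$ is $G_{r,n}^Q:E^n\to\mathbb R_+$, $G_{r,n}^Q(a_1,\ldots,a_n)=\int_E\min_{1\le i\le n}\|x-a_i\|^r\,dQ(x)$. For a Borel set $C$ with $P(C)>0$, $P(\cdot\mid C)=P(\cdot\cap C)/P(C)$. An $L^r$-optimal $1$-quantizer for $Q$ is a singleton $\{y\}$ minimizing $G^Q_{r,1}$ over $E$. For a finite $\Gamma\subset E$ and $b\in\Gamma$: the closed Voronoi cell is $V_b(\Gamma)=\{x\in E:\|x-b\|=d(x,\Gamma)\}$ and the open Voronoi cell is $W_b(\Gamma)=\{x\in E:\|x-b\|<d(x,\Gamma\setminus\{b\})\}$. A Voronoi partition induced by $\Gamma$ is a Borel partition $\{C_b(\Gamma):b\in\Gamma\}$ of $E$ with $C_b(\Gamma)\subset V_b(\Gamma)$ for all $b$. $\Gamma$ is admissible for $P$ if $P\big(\bigcup_{b\in\Gamma}W_b(\Gamma)\big)=1$. The norm is Gâteaux differentiable at $x\ne0$ if there is $\nabla\|\cdot\|(x)\in E^*$ with $\lim_{t\to0}(\|x+ty\|-\|x\|)/t=\langle\nabla\|\cdot\|(x),y\rangle$ for all $y\in E$. Assume $r\ge1$, $\int\|x\|^r dP<\infty$, and that for every $b\in E$ the norm is Gâteaux differentiable at $b-x$ for $P(dx)$-a.e.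 $x\in E\setminus\{b\}$. A set $\Gamma\subset E$ with $\operatorname{card}(\Gamma)=n$ (and $P(\Gamma)=0$ if $r=1$) is an $L^r$-stationary $n$-quantizer for $P$ if there exists a Voronoi partition $\{C_b(\Gamma):b\in\Gamma\}$ induced by $\Gamma$ such that, for every $b\in\Gamma$, $P(C_b(\Gamma))>0$ and \[ \mathbb E\big[\mathbf 1_{C_b(\Gamma)\setminus\{b\}}(X)\,\|X-b\|^{r-1}\,\nabla\|\cdot\|(b-X)\big]=0\quad\text{in }E^*, \] the expectation being a Gelfand integral. *)

(* Defs.v *)
From HB Require Import structures.
From mathcomp Require Import all_boot all_order all_algebra.
From mathcomp Require Import all_classical all_reals all_analysis.
Set Implicit Arguments. Unset Strict Implicit. Unset Printing Implicit Defensive.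
Import Order.TTheory GRing.Theory Num.Theory.
Import numFieldNormedType.Exports.
Local Open Scope classical_set_scope.
Local Open Scope ring_scope.

Section QuantDefs.
Context {R : realType} {E : normedModType R}.

Definition borelE := g_sigma_algebraType (@open E).

Definition radon (P : set borelE -> \bar R) :=
  forall B : set borelE, measurable B ->
    P B = ereal_sup [set P K | K in [set K : set E | compact K /\ K `<=` B]].

Definition mes_support (P : set borelE -> \bar R) : set E :=
  [set x | forall U : set E, open U -> U x -> (0 < P U)%E].

Definition non_isolated (S : set E) (x : E) :=
  S x /\ forall U : set E, nbhs x U -> exists y, [/\ S y, y != x & U y].

Definition distortion (Q : set borelE -> \bar R) (r : R) (n : nat)
    (a : 'I_n -> E) : \bar R :=
  (\int[Q]_x \big[Order.min/+oo%E]_(i < n) ((`|(x : E) - a i| `^ r)%:E))%E.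

Definition cond (P : set borelE -> \bar R) (C : set E) : set borelE -> \bar R :=
  fun A => (((fine (P C))^-1)%:E * P (A `&` C))%E.

Definition vcell (Gam : set E) (b : E) : set E :=
  [set x | forall c, Gam c -> `|x - b| <= `|x - c|].
Definition ocell (Gam : set E) (b : E) : set E :=
  [set x | forall c, Gam c -> c != b -> `|x - b| < `|x - c|].

Definition voronoi_partition (Gam : set E) (C : E -> set E) :=
  [/\ forall b, Gam b -> measurable (C b : set borelE) /\ C b `<=` vcell Gam b,
      forall b c, Gam b -> Gam c -> b != c -> C b `&` C c = set0
    & \bigcup_(b in Gam) C b = setT].

Definition admissible (P : set borelE -> \bar R) (Gam : set E) :=
  P (\bigcup_(b in Gam) ocell Gam b) = 1%E.

Definition norm_gateaux (x : E) :=
  exists l : E -> R,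
    [/\ forall u v, l (u + v) = l u + l v,
        forall (c : R) u, l (c *: u) = c * l u,
        continuous l
      & forall y, (fun t : R => (`|x + t *: y| - `|x|) / t) @ 0^' --> l y].

Definition norm_grad (x y : E) : R :=
  lim ((fun t : R => (`|x + t *: y| - `|x|) / t) @ 0^').

(* L^r-stationary n-quantizer (pairing the Gelfand integral with every y). *)
Definition stationary (P : set borelE -> \bar R) (r : R) (n : nat) (Gam : set E) :=
  [/\ (Gam #= `I_n)%card,
      (r = 1 -> P (Gam : set borelE) = 0%E)
    & exists C : E -> set E, voronoi_partition Gam C /\
        forall b, Gam b -> (0 < P (C b))%E /\
          forall y : E,
            let f := fun x : borelE =>
              ((`|(x : E) - b| `^ (r - 1)) * norm_grad (b - x) y)%:E in
            P.-integrable (C b `\ b : set borelE) f /\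
            (\int[P]_(x in (C b `\ b : set borelE)) f x)%E = 0%E].

Definition strictly_convex :=
  forall x y : E, `|x| = 1 -> `|y| = 1 -> x != y -> `|2^-1 *: (x + y)| < 1.

End QuantDefs.

(* Main.v *)
(* If two components of a local minimum coincide, one of them can be moved to a
   nearby support point outside the codebook, which lowers the distortion.
   Moving a_i to y, and keeping the old cells otherwise, shows that a_i locally
   minimizes y |-> int_C |x - y|^r; for r >= 1 this function is convex, so the
   minimum is global. The secant slopes of t |-> |a_i - x + t y|^r are monotone
   in t, hence dominated by their values at t = 1 and t = -1, and dominated
   convergence turns the minimality into stationarity on every Borel set C
   between the open and the closed cell. Comparing C = V_i with
   C = V_i \ (V_i & V_j) shows that the gradient in the direction a_i - a_j
   integrates to 0 over V_i & V_j, where strict convexity makes it positive;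
   hence V_i & V_j is P-null. *)
Require Import Defs.
From HB Require Import structures.
From mathcomp Require Import all_boot all_order all_algebra.
From mathcomp Require Import all_classical all_reals all_analysis.
From mathcomp Require Import measurable_realfun.
From mathcomp Require Import ring lra.
Import Order.TTheory GRing.Theory Num.Theory.
Import numFieldNormedType.Exports.
Local Open Scope classical_set_scope.
Local Open Scope ring_scope.

(** * Secant slopes of convex functions on the real line *)

Section Secants.
Context {R : realType}.
Implicit Types (phi : R -> R) (s t : R).

Definition convex_real phi := forall k s t, 0 <= k -> k <= 1 ->
  phi (k * s + (1 - k) * t) <= k * phi s + (1 - k) * phi t.

Definition secant phi t := (phi t - phi 0) / t.

(** The point s is the convex combination of t and 0 with weight s / t on t; convexity there,
    rearranged, compares the slopes. *)
Lemma secant_nondecreasing phi s t : convex_real phi -> 0 < s -> s <= t ->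
  secant phi s <= secant phi t.
Proof.
move=> cphi s0 st; have t0 : 0 < t by exact: lt_le_trans st.
rewrite /secant ler_pdivrMr // mulrAC ler_pdivlMr //.
have k0 : 0 <= s / t by rewrite divr_ge0 // ltW.
have k1 : s / t <= 1 by rewrite ler_pdivrMr // mul1r.
have := cphi (s / t) t 0 k0 k1.
rewrite mulr0 addr0 divfK ?gt_eqF // => h.
have := ler_wpM2r (ltW t0) h.
rewrite mulrDl -mulrA (mulrC (phi t)) mulrA divfK ?gt_eqF //.
rewrite mulrBl mul1r mulrBl -(mulrA (s / t)) (mulrC (phi 0) t).
rewrite mulrA divfK ?gt_eqF //.
by nra.
Qed.

(** Here 0 is the convex combination of t and - s with weights s / (s + t) and t / (s + t). *)
Lemma secant_opp_le phi s t : convex_real phi -> 0 < s -> 0 < t ->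
  secant phi (- s) <= secant phi t.
Proof.
move=> cphi s0 t0.
have st0 : 0 < s + t by rewrite addr_gt0.
have k0 : 0 <= s / (s + t) by rewrite divr_ge0 // ltW.
have k1 : s / (s + t) <= 1 by rewrite ler_pdivrMr // mul1r lerDl ltW.
have := cphi (s / (s + t)) t (- s) k0 k1.
have -> : 1 - s / (s + t) = t / (s + t) by field; rewrite gt_eqF.
have -> : s / (s + t) * t + t / (s + t) * - s = 0 by field; rewrite gt_eqF.
rewrite -!(mulrAC _ _ (s + t)^-1) -mulrDl ler_pdivlMr // => h.
rewrite /secant invrN mulrN -mulNr ler_pdivrMr // mulrAC ler_pdivlMr //.
by nra.
Qed.

(** As t decreases to 0 the slopes decrease, and the slope at -1 bounds them from below. *)
Lemma is_cvg_secant_right phi : convex_real phi ->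
  cvg (secant phi t @[t --> 0^'+]).
Proof.
move=> cphi; apply: nondecreasing_at_right_is_cvgr.
  near=> u; move=> s t; rewrite !in_itv /= => /andP[s0 _] _ st.
  exact: secant_nondecreasing.
near=> u; exists (secant phi (- 1)) => w [t]; rewrite /= in_itv /= => /andP[t0 _] <-.
exact: secant_opp_le.
Unshelve. all: by end_near. Qed.

(** Passing to the steps 1 / (n + 1) gives a sequence, as needed for measurability of limits and for
    dominated convergence. *)
Lemma cvg_secant_harmonic phi (l : R) : secant phi t @[t --> 0^'+] --> l ->
  secant phi (harmonic n) @[n --> \oo] --> l.
Proof.
move=> /cvg_at_rightP; apply; split => [n|]; last exact: cvg_harmonic.
by rewrite harmonic_gt0.
Qed.

(** The slope at t lies between the slopes at -1 and 1. The bound does not depend on t, which makes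
    it a dominating function later. *)
Lemma secant_bound phi t : convex_real phi -> 0 < t -> t <= 1 ->
  `|secant phi t| <= `|phi 1| + `|phi (- 1)| + `|phi 0|.
Proof.
move=> cphi t0 t1.
have h1 := secant_nondecreasing _ _ _ cphi t0 t1.
have h2 := secant_opp_le _ _ _ cphi ltr01 t0.
move: h1 h2; rewrite /secant divr1 invrN invr1 mulrN1 => h1 h2.
have := ler_norm (phi 1); have := ler_norm (- phi 1).
have := ler_norm (phi (-1)); have := ler_norm (- phi (-1)).
have := ler_norm (phi 0); have := ler_norm (- phi 0).
rewrite !normrN => *.
by rewrite ler_norml; apply/andP; split; lra.
Qed.

End Secants.

(** * Powers of the norm along lines and their directional derivatives *)

Section NormPowers.
Context {R : realType} {E : normedModType R}.
Implicit Types (y z : E) (r t : R).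

(** The triangle inequality and monotonicity of the power reduce this to convexity of the r-th power
    on the nonnegative reals. *)
Lemma norm_powR_conv_le r (u v : E) (k : R) : 1 <= r -> 0 <= k -> k <= 1 ->
  `|k *: u + (1 - k) *: v| `^ r <= k * `|u| `^ r + (1 - k) * `|v| `^ r.
Proof.
move=> r1 k0 k1.
have r0 : 0 <= r by exact: le_trans r1.
have k1' : 0 <= 1 - k by rewrite subr_ge0.
apply: (@le_trans _ _ ((k * `|u| + (1 - k) * `|v|) `^ r)).
  apply: ge0_ler_powR => //; rewrite ?nnegrE ?normr_ge0 //.
    by rewrite addr_ge0 // mulr_ge0.
  by rewrite (le_trans (ler_normD _ _)) // !normrZ ger0_norm // (@ger0_norm _ (1 - k)).
have nn (w : E) : `|w| \in (`[0, +oo[%classic : set R).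
  by rewrite inE /= in_itv /= andbT.
have := convex_powR r1 (Itv01 k0 k1) (nn u) (nn v).
by rewrite !convRE /= /unstable.onem.
Qed.

Lemma convex_norm_powR r z y : 1 <= r -> convex_real (fun t => `|z + t *: y| `^ r).
Proof.
move=> r1 k s t k0 k1.
apply: le_trans (norm_powR_conv_le _ _ _ _ r1 k0 k1).
rewrite le_eqVlt; apply/orP; left; apply/eqP; congr (`|_| `^ _).
rewrite !scalerDr addrACA -scalerDl subrKC scale1r; congr (_ + _).
by rewrite !scalerA -scalerDl.
Qed.

Lemma convex_norm_line z y : convex_real (fun t => `|z + t *: y|).
Proof.
move=> k s t k0 k1; have := convex_norm_powR _ z y (lexx 1) k s t k0 k1.
by rewrite !powRr1.
Qed.

(** The right directional derivative of the norm at z along y; by convexity this limit exists for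
    all z and y. *)
Definition norm_dplus z y : R := lim (secant (fun t => `|z + t *: y|) t @[t --> 0^'+]).

Lemma cvg_norm_dplus z y :
  secant (fun t => `|z + t *: y|) t @[t --> 0^'+] --> norm_dplus z y.
Proof. exact/is_cvg_secant_right/convex_norm_line. Qed.

Lemma norm_quotientE z y :
  (fun t : R => (`|z + t *: y| - `|z|) / t) = secant (fun t => `|z + t *: y|).
Proof. by apply/funext => t; rewrite /secant scale0r addr0. Qed.

(** Replacing t by - t turns left slopes along y into opposites of right slopes along - y. *)
Lemma cvg_norm_dminus z y :
  secant (fun t => `|z + t *: y|) t @[t --> 0^'-] --> - norm_dplus z (- y).
Proof.
apply/cvg_at_leftNP; rewrite oppr0.
rewrite (_ : _ \o _ = (fun t => - secant (fun t => `|z + t *: - y|) t)).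
  by apply: cvgN; exact: cvg_norm_dplus.
by apply/funext => t /=; rewrite /secant !scale0r invrN mulrN scalerN scaleNr.
Qed.

(* The norm being convex, both one-sided derivatives exist everywhere; this makes
   norm_grad measurable in its first argument, junk values included. *)
Lemma norm_gradE z y : norm_grad z y =
  if norm_dplus z y == - norm_dplus z (- y) then norm_dplus z y else point.
Proof.
rewrite /norm_grad norm_quotientE; case: ifPn => [/eqP e|/eqP ne].
  have hL := cvg_norm_dminus z y; rewrite -e in hL.
  by apply: cvg_lim => //; exact: (@cvg_at_right_left_dnbhs _ R^o _ _ _ (cvg_norm_dplus z y) hL).
apply: dvgP => /cvg_ex[l hl]; apply: ne.
have /cvg_dnbhs_at_right hr := hl; have /cvg_dnbhs_at_left hL := hl.
transitivity l.
  by apply: (cvg_unique _ _ hr) => //; exact: cvg_norm_dplus.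
by apply: (cvg_unique _ hL) => //; exact: cvg_norm_dminus.
Qed.

Lemma cvg_norm_grad z y : norm_gateaux z ->
  secant (fun t => `|z + t *: y|) t @[t --> 0^'] --> norm_grad z y.
Proof.
move=> [l [_ _ _ /(_ y) hl]]; rewrite /norm_grad norm_quotientE in hl *.
by apply/cvg_ex; exists (l y).
Qed.

Lemma norm_gradN z y : norm_gateaux z -> norm_grad z (- y) = - norm_grad z y.
Proof.
move=> [l [_ lZ _ hl]].
have lim_l v : norm_grad z v = l v by apply: cvg_lim => //; exact: hl.
by rewrite !lim_l -scaleN1r lZ mulN1r.
Qed.

(** Chain rule: z being nonzero, the r-th power is differentiable at the positive number [|z|]. *)
Lemma cvg_secant_norm_powR r z y : z != 0 -> norm_gateaux z ->
  secant (fun t => `|z + t *: y| `^ r) t @[t --> 0^'] -->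
  r * (`|z| `^ (r - 1) * norm_grad z y).
Proof.
move=> z0 /(cvg_norm_grad _ y) h.
pose g := fun t : R => `|z + t *: y|.
have g0 : g 0 = `|z| by rewrite /g scale0r addr0.
have dg : is_derive (0 : R) 1 g (norm_grad z y).
  have hq : (fun t : R => t^-1 *: ((g \o shift 0) (t *: 1) - g 0)) = secant g.
    by apply/funext => t; rewrite /secant /= addr0 [_ *: 1]mulr1 /GRing.scale /= mulrC.
  split; first by rewrite /derivable hq; apply/cvg_ex; eexists; exact: h.
  by rewrite /derive hq; apply: cvg_lim.
have dp : is_derive (g 0) 1 (fun x => x `^ r) (r * (g 0) `^ (r - 1)).
  by apply: is_derive1_powR; rewrite g0 normr_gt0.
have [] := is_derive1_comp dp dg.
rewrite /derivable /derive.
have -> : (fun h : R => h^-1 *: ((((fun x => x `^ r) \o g) \o shift 0) (h *: 1) -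
    ((fun x => x `^ r) \o g) 0)) = secant (fun t => g t `^ r).
  by apply/funext => t; rewrite /secant /= addr0 [_ *: 1]mulr1 /GRing.scale /= mulrC.
by rewrite g0 mulrA => ? <-.
Qed.

End NormPowers.

(** * A criterion for null sets *)

Section AlmostEverywhere.
Context d (T : measurableType d) (R : realType) (mu : {measure set T -> \bar R}).

(** Since f agrees a.e. on A with its absolute value, the latter has integral 0, so f vanishes a.e.
    on A; being also positive there, it leaves A null. *)
Lemma ae_pos_integral_le0_null (A : set T) (f : T -> \bar R) :
  measurable A -> mu.-integrable A f ->
  {ae mu, forall x, A x -> (0 < f x)%E} ->
  (\int[mu]_(x in A) f x <= 0)%E -> mu A = 0%E.
Proof.
move=> mA intf fpos le0; have mf := measurable_int mu intf.
have abs0 : (\int[mu]_(x in A) `|f x| = 0)%E.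
  apply/eqP; rewrite eq_le integral_ge0 ?andbT //.
  rewrite (@ae_eq_integral _ _ _ _ _ f) //; first exact: measurableT_comp.
  apply: filterS fpos => x fx Ax.
  by rewrite gee0_abs //; exact/ltW/fx.
have /(ae_eq_integral_abs mu mA mf) f0 := abs0.
apply/(measure_negligible mA).
have : {ae mu, forall x, ~ A x}.
  by apply: filterS2 fpos f0 => x fx f0x Ax; move: (fx Ax); rewrite f0x // ltxx.
by apply: negligibleS => x Ax; exact.
Qed.

End AlmostEverywhere.

(** * Borel measurability of distances, gradients and Voronoi cells *)

Section Borel.
Context {R : realType} {E : normedModType R}.
Local Notation B := (@borelE R E).

Lemma open_borel (U : set E) : open U -> measurable (U : set B).
Proof. by move=> oU; exact: sub_sigma_algebra. Qed.

Lemma continuous_borel (f : E -> R) : continuous f ->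
  measurable_fun setT (f : B -> R).
Proof.
move=> /continuousP cf; apply: (measurability _ (RGenOpens.measurableE R)).
move=> _ [_ [a [b ->] <-]]; rewrite setTI.
by apply: open_borel; apply: cf; exact: interval_open.
Qed.

Lemma continuous_norm_shift (v : E) : continuous (fun x : E => `|x + v|).
Proof.
move=> x; apply: (continuous_comp (f := fun x : E => x + v)); last exact: norm_continuous.
by apply: cvgD; [exact: cvg_id|exact: cvg_cst].
Qed.

Lemma measurable_dist (b : E) : measurable_fun setT (fun x : B => `|(x : E) - b|).
Proof. by apply: continuous_borel; exact: continuous_norm_shift. Qed.

Lemma measurable_dist_powR (b : E) (r : R) :
  measurable_fun setT (fun x : B => `|(x : E) - b| `^ r).
Proof.
exact: (measurableT_comp (measurable_powR r) (measurable_dist b)).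
Qed.

(** A pointwise limit of slopes, each a multiple of a difference of distances from x to two fixed
    points. *)
Lemma measurable_norm_dplus (b y : E) :
  measurable_fun setT (fun x : B => norm_dplus (b - x) y).
Proof.
apply: (@measurable_fun_cvg _ _ _ _
  (fun n (x : B) => secant (fun t => `|b - (x : E) + t *: y|) (harmonic n))).
  move=> n; rewrite /secant; apply: measurable_funM => //.
  have mt (t : R) : measurable_fun setT (fun x : B => `|b - (x : E) + t *: y|).
    rewrite (_ : (fun _ => _) = (fun x : B => `|(x : E) - (b + t *: y)|)).
      exact: measurable_dist.
    by apply/funext => x; rewrite -normrN !opprD opprK addrA (addrC (- b)).
  by apply: measurable_funB; exact: mt.
by move=> x _; apply: cvg_secant_harmonic; exact: cvg_norm_dplus.
Qed.

Lemma measurable_norm_grad (b y : E) :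
  measurable_fun setT (fun x : B => norm_grad (b - x) y).
Proof.
under eq_fun do rewrite norm_gradE.
apply: measurable_fun_ifT => //; last exact: measurable_norm_dplus.
apply: measurable_fun_eqr; first exact: measurable_norm_dplus.
by apply: measurable_funN; exact: measurable_norm_dplus.
Qed.

Lemma closed_nearer (b c : E) : closed [set x : E | `|x - b| <= `|x - c|].
Proof.
rewrite (_ : mkset _ = (fun x : E => `|x - c| - `|x - b|) @^-1` [set t | 0 <= t]).
  apply: preimage_closed; last exact: closed_ge.
  by move=> x _; apply: cvgB; exact: continuous_norm_shift.
by apply/seteqP; split => x /=; rewrite subr_ge0.
Qed.

Lemma closed_vcell (Gam : set E) (b : E) : closed (vcell Gam b).
Proof.
rewrite (_ : vcell _ _ = \bigcap_(c in Gam) [set x | `|x - b| <= `|x - c|]).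
  by apply: closed_bigI => c _; exact: closed_nearer.
by apply/seteqP; split => x /= h c /h.
Qed.

Lemma measurable_vcell (Gam : set E) (b : E) : measurable (vcell Gam b : set B).
Proof.
rewrite -[vcell _ _]setCK; apply: measurableC; apply: open_borel.
exact/closed_openC/closed_vcell.
Qed.

(** For finite [Gam] the complement is a finite union of closed sets. *)
Lemma open_ocell (Gam : set E) (b : E) : finite_set Gam -> open (ocell Gam b).
Proof.
move=> fG; rewrite -[ocell _ _]setCK openC.
rewrite (_ : ~` ocell _ _ =
    \bigcup_(c in Gam `\ b) [set x | `|x - c| <= `|x - b|]).
  by apply: closed_bigcup => [|c _]; [exact: finite_setD|exact: closed_nearer].
apply/seteqP; split => x /=; last first.
  by move=> [c [Gc /eqP cb] /= xcb] /(_ c Gc cb); rewrite ltNge xcb.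
move=> nx; apply: contrapT => nex; apply: nx => c Gc cb.
by rewrite ltNge; apply/negP => xcb; apply: nex; exists c => //; split => //; exact/eqP.
Qed.

End Borel.

(** * The cost of a single code point and its integrability *)

Section Cost.
Context {R : realType} {E : normedModType R} (P : probability (@borelE R E) R) (r : R).
Local Notation B := (@borelE R E).
Hypothesis r_gt0 : 0 < r.
Hypothesis moment : (\int[P]_x ((`|(x : E)| `^ r)%:E) < +oo)%E.

Definition cost (b : E) (x : B) : \bar R := (`|(x : E) - b| `^ r)%:E.

Lemma cost_ge0 b x : (0 <= cost b x)%E.
Proof. by rewrite lee_fin powR_ge0. Qed.

Lemma measurable_cost (b : E) (D : set B) : measurable_fun D (cost b).
Proof.
apply: (measurable_funS measurableT) => //.
by apply/measurable_EFinP; exact: measurable_dist_powR.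
Qed.

(** The distance from x to b is at most twice the larger of the norms of x and b, so the cost is at
    most the sum of the r-th powers of [2 * |x|] and [2 * |b|]. This covers r < 1 as well. *)
Lemma integrable_cost (b : E) (D : set B) : measurable D -> P.-integrable D (cost b).
Proof.
move=> mD; apply: (integrableS measurableT) => //.
pose g (x : B) := ((2 `^ r)%:E * cost 0%R x + ((2 * `|b|) `^ r)%:E)%E.
apply: (le_integrable _ (g := g)) => //; first exact: measurable_cost.
  move=> x _; rewrite !gee0_abs ?cost_ge0 //; last first.
    by rewrite adde_ge0 // ?mule_ge0 ?cost_ge0 // lee_fin powR_ge0.
  rewrite /g /cost -EFinM -EFinD lee_fin subr0 -powRM //.
  have h : `|(x : E) - b| <= `|(x : E)| + `|b| by exact: ler_normB.
  have [xb|/ltW bx] := leP (`|(x : E)|) (`|b|).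
    apply: (@le_trans _ _ ((2 * `|b|) `^ r)); last by rewrite lerDr powR_ge0.
    by apply: ge0_ler_powR; rewrite ?nnegrE ?mulr_ge0 ?(ltW r_gt0) //; lra.
  apply: (@le_trans _ _ ((2 * `|(x : E)|) `^ r)); last by rewrite lerDl powR_ge0.
  by apply: ge0_ler_powR; rewrite ?nnegrE ?mulr_ge0 ?(ltW r_gt0) //; lra.
apply: integrableD => //; last exact: finite_measure_integrable_cst.
apply: integrableZl => //; apply/integrableP; split; first exact: measurable_cost.
under eq_integral do rewrite gee0_abs ?cost_ge0 // /cost subr0.
exact: moment.
Qed.

End Cost.

(** * Integration against a conditional distribution *)

Section Conditioning.
Context {R : realType} {E : normedModType R} (P : probability (@borelE R E) R).
Local Notation B := (@borelE R E).

Lemma integral_cond (C : set E) (f : B -> \bar R) :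
  measurable (C : set B) -> measurable_fun setT f -> (forall x, (0 <= f x)%E) ->
  (\int[cond P C]_x f x = ((fine (P C))^-1)%:E * \int[P]_(x in (C : set B)) f x)%E.
Proof.
move=> mC mf f0.
have k0 : 0 <= (fine (P C))^-1 by rewrite invr_ge0 fine_ge0.
(* [cond] is a bare set function; unfolded, it is a scaled restriction of P, which carries a measure
   structure. *)
have -> : cond P C = mscale (NngNum k0) (mrestr P mC) by [].
rewrite ge0_integral_mscale //=; congr (_ * _)%E.
rewrite -(setUv (C : set B)) ge0_integral_setU //; last 3 first.
- exact: measurableC.
- by rewrite setUv.
- by apply/disj_setPS; rewrite setICr.
have mCC := measurableC mC.
have -> : (\int[mrestr P mC]_(x in ~` (C : set B)) f x = 0)%E.
  apply: null_set_integral => //; first exact: measurable_funS mf.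
  by rewrite /= /mrestr setICl measure0.
rewrite adde0; apply: eq_measure_integral => A mA AC.
by rewrite /= /mrestr (setIidl AC).
Qed.

End Conditioning.

(** * Distortion and its local minima *)

Section Distortion.
Context {R : realType} {E : normedModType R} (P : probability (@borelE R E) R) (r : R).
Local Notation B := (@borelE R E).
Local Notation cost := (@cost R E r).
Hypothesis r_gt0 : 0 < r.
Hypothesis moment : (\int[P]_x ((`|(x : E)| `^ r)%:E) < +oo)%E.

Let int_cost := @integrable_cost R E P r r_gt0 moment.

Lemma cost_le (b c : E) (x : B) :
  (cost b x <= cost c x)%E = (`|(x : E) - b| <= `|(x : E) - c|).
Proof.
rewrite lee_fin; apply/idP/idP => [|bc].
  by apply: contraTT; rewrite -!ltNge; apply: gt0_ltr_powR; rewrite ?nnegrE.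
by apply: ge0_ler_powR; rewrite ?nnegrE // ltW.
Qed.

Lemma cost_lt (b c : E) (x : B) :
  (cost b x < cost c x)%E = (`|(x : E) - b| < `|(x : E) - c|).
Proof. by rewrite !ltNge cost_le. Qed.

(** The integrand of [distortion]. *)
Definition mincost {n} (a : 'I_n -> E) (x : B) : \bar R :=
  \big[Order.min/+oo%E]_(i < n) cost (a i) x.

Lemma mincost_ge0 {n} (a : 'I_n -> E) x : (0 <= mincost a x)%E.
Proof. by apply: le_bigmin => // i _; exact: cost_ge0. Qed.

Lemma mincost_le {n} (a : 'I_n -> E) i x : (mincost a x <= cost (a i) x)%E.
Proof. exact: bigmin_le. Qed.

Lemma mincost_fin_num {n} (a : 'I_n -> E) (i : 'I_n) x : mincost a x \is a fin_num.
Proof.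
by rewrite ge0_fin_numE ?mincost_ge0 // (le_lt_trans (mincost_le a i x)) // ltry.
Qed.

Lemma measurable_mincost {n} (a : 'I_n -> E) (D : set B) : measurable_fun D (mincost a).
Proof.
apply: (measurable_funS measurableT) => //.
elim: n a => [|n IH] a; rewrite /mincost.
  by under eq_fun do rewrite big_ord0; exact: measurable_cst.
under eq_fun do rewrite big_ord_recl.
apply: measurable_mine; [exact: measurable_cost|exact: IH].
Qed.

Lemma integrable_mincost {n} (a : 'I_n -> E) (i : 'I_n) (D : set B) :
  measurable D -> P.-integrable D (mincost a).
Proof.
move=> mD; apply: le_integrable (int_cost (a i) D mD) => //.
  exact: measurable_mincost.
by move=> x _; rewrite !gee0_abs ?mincost_ge0 ?cost_ge0 // mincost_le.
Qed.

(** Otherwise the nonnegative difference of the integrands has integral at most 0 while being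
    positive on U, so U would be null. The index [i] guarantees that the minima are finite. *)
Lemma distortion_lt {n} (a b : 'I_n -> E) (i : 'I_n) (U : set E) :
  measurable (U : set B) -> (0 < P U)%E ->
  (forall x, mincost b x <= mincost a x)%E ->
  (forall x, U x -> mincost b x < mincost a x)%E ->
  (distortion P r b < distortion P r a)%E.
Proof.
move=> mU PU ba baU; rewrite ltNge; apply/negP => ab.
have ia := integrable_mincost a i; have ib := integrable_mincost b i.
move: PU.
rewrite (@ae_pos_integral_le0_null _ _ _ P U (fun x => mincost a x - mincost b x)%E) ?ltxx //.
- exact: integrableB (ia _ mU) (ib _ mU).
- by apply: aeW => x Ux; rewrite sube_gt0 baU.
apply: (@le_trans _ _ (\int[P]_x (mincost a x - mincost b x))%E).
  apply: ge0_subset_integral => //; last by move=> x _; rewrite sube_ge0 ?ba // (mincost_fin_num _ i).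
  exact: (measurable_int P (integrableB measurableT (ia _ measurableT) (ib _ measurableT))).
rewrite integralB ?ia ?ib //; rewrite sube_le0 //.
Qed.

Definition update {n} (a : 'I_n -> E) (i : 'I_n) (y : E) : 'I_n -> E :=
  fun j => if j == i then y else a j.

Section LocalMinimum.
Context n (a : 'I_n -> E) (e : R).
Hypothesis e_gt0 : 0 < e.
Hypothesis a_min : forall b : 'I_n -> E, (forall i, `|b i - a i| < e) ->
  (distortion P r a <= distortion P r b)%E.

Lemma update_min i y : `|y - a i| < e ->
  (distortion P r a <= distortion P r (update a i y))%E.
Proof.
move=> ye; apply: a_min => j; rewrite /update.
by case: eqP => [->|]; rewrite ?subrr ?normr0.
Qed.

Lemma ocell_self (Gam : set E) (b : E) : ocell Gam b b.
Proof. by move=> c _ cb; rewrite subrr normr0 normr_gt0 subr_eq0 eq_sym. Qed.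

Hypothesis a_supp : forall i, non_isolated (mes_support P) (a i).

Lemma finite_range_ord : finite_set (range a).
Proof. exact: finite_image. Qed.

Lemma local_min_inj : injective a.
Proof.
move=> i j aij; apply: contrapT => /eqP ij.
(* The ball keeps the displacement within reach of local minimality; the open cell keeps y away from
   the other code points. *)
have [_ /(_ (ball (a i) e `&` ocell (range a) (a i)))[]] := a_supp i.
  apply: filterI; first exact: nbhsx_ballx.
  apply: open_nbhs_nbhs; split; last exact: ocell_self.
  exact/open_ocell/finite_range_ord.
move=> y [ysupp yai [yball ycell]].
have yn k : y != a k.
  apply/eqP => yk; have [kai|kai] := eqVneq (a k) (a i).
    by move: yai; rewrite yk kai eqxx.
  have := ycell (a k) (imageP a I) kai.
  by rewrite yk subrr normr0 ltNge normr_ge0.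
(* The duplicate a_j moves to y. U is the open cell of y in the enlarged codebook, of positive mass
   because y is in the support. *)
pose b := update a j y; pose U := ocell (y |` range a) y.
have oU : open U.
  by apply: open_ocell; rewrite finite_setU; split => //; exact: finite_range_ord.
have PU : (0 < P U)%E by apply: ysupp => //; exact: ocell_self.
have yU x : U x -> (mincost b x < mincost a x)%E.
  move=> Ux; apply: (@le_lt_trans _ _ (cost y x)).
    by have := mincost_le b j x; rewrite /b /update eqxx.
  apply/bigmin_gtP; split => [|k _]; first exact: ltry.
  rewrite cost_lt; apply: Ux; first by right.
  by rewrite eq_sym.
have ba x : (mincost b x <= mincost a x)%E.
  apply: le_bigmin; first exact: leey.
  (* Nothing is lost by moving a_j: its old position is still occupied by a_i. *)
  move=> k _; have [->|kj] := eqVneq k j.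
    have := mincost_le b i x; rewrite /b /update (negbTE ij).
    by rewrite -aij.
  by have := mincost_le b k x; rewrite /b /update (negbTE kj).
have := distortion_lt a b i U (open_borel _ oU) PU ba yU.
apply/negP; rewrite -leNgt; apply: update_min.
by rewrite -aij; move: yball; rewrite -ball_normE /= distrC.
Qed.

Section Cell.
Context (i : 'I_n) (C : set E).
Hypothesis mC : measurable (C : set B).
Hypothesis oC : ocell (range a) (a i) `<=` C.
Hypothesis Cv : C `<=` vcell (range a) (a i).

(** The open cell is an open neighbourhood of the support point a_i. *)
Lemma cell_pos : (0 < P C)%E.
Proof.
have oW : open (ocell (range a) (a i)) by exact/open_ocell/finite_range_ord.
apply: (@lt_le_trans _ _ (P (ocell (range a) (a i)))).
  by have [+ _] := a_supp i; apply => //; exact: ocell_self.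
by apply: le_measure => //; rewrite inE //; exact: open_borel.
Qed.

(** On C the old minimum is the cost of a_i and the new one is at most the cost of y; off C the new
    minimum is at most the old one. The finite contribution off C cancels. *)
Lemma cell_local_min y : `|y - a i| < e ->
  (\int[P]_(x in (C : set B)) cost (a i) x <= \int[P]_(x in (C : set B)) cost y x)%E.
Proof.
move=> ye; have mCC : measurable (~` C : set B) by exact: measurableC.
have dC : [disjoint (C : set B) & (~` C : set B)] by apply/disj_setPS; rewrite setICr.
pose b := update a i y.
have split_int (c : 'I_n -> E) : distortion P r c =
    (\int[P]_(x in (C : set B)) mincost c x +
     \int[P]_(x in (~` C : set B)) mincost c x)%E.
  rewrite -ge0_integral_setU //; first by rewrite setUv.
    exact: measurable_mincost.
  by move=> x _; exact: mincost_ge0.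
have out_fin : (\int[P]_(x in (~` C : set B)) mincost a x)%E \is a fin_num.
  exact: integrable_fin_num (integrable_mincost a i _ mCC).
rewrite -(leeD2rE _ _ out_fin).
apply: (@le_trans _ _ (distortion P r a)).
  rewrite split_int leeD2rE //; apply: ge0_le_integral => //.
  - by move=> x _; exact: cost_ge0.
  - exact: measurable_cost.
  - exact: measurable_mincost.
  move=> x Cx; apply: le_bigmin; first exact: leey.
  by move=> k _; rewrite cost_le; exact: (Cv _ Cx).
apply: (le_trans (update_min i y ye)); rewrite split_int; apply: leeD.
  apply: ge0_le_integral => //.
  - by move=> x _; exact: mincost_ge0.
  - exact: measurable_mincost.
  - exact: measurable_cost.
  by move=> x Cx; have := mincost_le b i x; rewrite /b /update eqxx.
apply: ge0_le_integral => //.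
- by move=> x _; exact: mincost_ge0.
- exact: measurable_mincost.
- exact: measurable_mincost.
move=> x nCx; apply: le_bigmin => [|k _]; first exact: leey.
have [->|ki] := eqVneq k i; last first.
  by have := mincost_le b k x; rewrite /b /update (negbTE ki).
(* Off C, hence off the open cell, some code point other than a_i is at least as near, and the
   update leaves it in place. *)
have [j ji xj] : exists2 j, j != i & `|(x : E) - a j| <= `|(x : E) - a i|.
  apply: contrapT => nex; apply/nCx/oC => _ [j _ <-] ji.
  rewrite ltNge; apply/negP => xj; apply: nex; exists j => //.
  by apply: contra_neq ji => ->.
rewrite -cost_le in xj; apply: le_trans xj.
by have := mincost_le b j x; rewrite /b /update (negbTE ji).
Qed.

Lemma cell_global_min y : 1 <= r ->
  (\int[P]_(x in (C : set B)) cost (a i) x <= \int[P]_(x in (C : set B)) cost y x)%E.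
Proof.
(* This k puts z, on the segment from a_i to y, at distance [k * |y - a i|] < e from a_i. Convexity
   then bounds the integral at a_i by k times that at y plus 1 - k times itself, and k > 0
   cancels. *)
move=> r1; pose k := e / (e + `|y - a i|).
have ey0 : 0 < e + `|y - a i| by rewrite ltr_wpDr.
have k0 : 0 < k by rewrite divr_gt0.
have k1 : k <= 1 by rewrite ler_pdivrMr // mul1r lerDl.
pose z := k *: y + (1 - k) *: a i.
have ze : `|z - a i| < e.
  have -> : z - a i = k *: (y - a i).
    by rewrite /z scalerBl scale1r scalerBr addrA addrAC addrK.
  rewrite normrZ (gtr0_norm k0) mulrAC ltr_pdivrMr // mulrDr ltrDr.
  by rewrite mulr_gt0.
have := cell_local_min z ze.
have : (\int[P]_(x in (C : set B)) cost z x <=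
   k%:E * \int[P]_(x in (C : set B)) cost y x +
   (1 - k)%:E * \int[P]_(x in (C : set B)) cost (a i) x)%E.
  have k1' : 0 <= 1 - k by rewrite subr_ge0.
  have mc c : measurable_fun (C : set B) (cost c) by exact: measurable_cost.
  have c0 c (x : B) : C x -> (0 <= cost c x)%E by move=> _; exact: cost_ge0.
  rewrite -!ge0_integralZl_EFin //; [|exact: c0|exact: c0|exact: ltW].
  rewrite -ge0_integralD //; last 4 first.
  - by move=> x _; rewrite mule_ge0 ?cost_ge0 // lee_fin ltW.
  - exact: measurable_funeM.
  - by move=> x _; rewrite mule_ge0 ?cost_ge0 // lee_fin.
  - exact: measurable_funeM.
  apply: ge0_le_integral => //; first exact: c0.
    by apply: emeasurable_funD; exact: measurable_funeM.
  move=> x _; rewrite /cost -!EFinM -EFinD lee_fin.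
  apply: le_trans (norm_powR_conv_le _ _ _ _ r1 (ltW k0) k1).
  rewrite le_eqVlt; apply/orP; left; apply/eqP; congr (`|_| `^ _).
  by rewrite !scalerBr addrACA -scalerDl subrKC scale1r /z opprD.
have fC c := integrable_fin_num mC (int_cost c _ mC).
rewrite -(fineK (fC y)) -(fineK (fC (a i))) -(fineK (fC z)) -!EFinM -EFinD !lee_fin.
set u := fine _; set v := fine _; set w := fine _ => h1 h2.
have := le_trans h2 h1; rewrite -subr_ge0 => h.
by rewrite -(ler_pM2l k0); lra.
Qed.

End Cell.
End LocalMinimum.
End Distortion.

(** * First-order condition for a minimizer of the integrated cost on a set *)

Section Stationarity.
Context {R : realType} {E : normedModType R} (P : probability (@borelE R E) R) (r : R).
Local Notation B := (@borelE R E).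
Local Notation cost := (@cost R E r).
Hypothesis r_ge1 : 1 <= r.
Hypothesis moment : (\int[P]_x ((`|(x : E)| `^ r)%:E) < +oo)%E.

Let r_gt0 : 0 < r. Proof. exact: lt_le_trans r_ge1. Qed.

Let int_cost := @integrable_cost R E P r r_gt0 moment.

Context (b : E) (C : set E).
Hypothesis mC : measurable (C : set B).
Hypothesis b_min : forall y,
  (\int[P]_(x in (C : set B)) cost b x <= \int[P]_(x in (C : set B)) cost y x)%E.
Hypothesis b_gateaux : {ae P, forall x : B, (x : E) != b -> norm_gateaux (b - x)}.
Hypothesis b_null : r = 1 -> P [set b] = 0%E.

(** For x other than b with the norm Gâteaux differentiable at b - x, this is 1 / r times the
    derivative of the cost when b moves along y. *)
Definition cost_grad (y : E) (x : B) : R :=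
  `|(x : E) - b| `^ (r - 1) * norm_grad (b - x) y.

Lemma measurable_borel1 : measurable ([set b] : set B).
Proof.
rewrite -[[set b]]setCK; apply: measurableC; apply: open_borel.
by apply: closed_openC; apply: accessible_closed_set1; apply: hausdorff_accessible.
Qed.

Let D : set B := C `\ b.

Lemma measurable_cell_setD1 : measurable D.
Proof. exact: measurableD mC measurable_borel1. Qed.

Lemma measurable_cost_grad (y : E) (A : set B) :
  measurable_fun A (fun x => (cost_grad y x)%:E).
Proof.
apply: (measurable_funS measurableT) => //; apply/measurable_EFinP.
by apply: measurable_funM; [exact: measurable_dist_powR|exact: measurable_norm_grad].
Qed.

Let phi (y : E) (x : B) (t : R) : R := `|b - (x : E) + t *: y| `^ r.

Let phi_cost y x t : (phi y x t)%:E = cost (b + t *: y) x.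
Proof.
rewrite /phi /cost; congr ((_ `^ _)%:E).
by rewrite -normrN !opprD opprK addrA (addrC (- b)).
Qed.

Let slope (y : E) (n : nat) (x : B) : \bar R := (secant (phi y x) (harmonic n))%:E.

Let slopeE y n x : slope y n x =
  (((harmonic n)^-1)%:E * (cost (b + harmonic n *: y)%R x - cost b x))%E.
Proof.
rewrite /slope /secant EFinM muleC EFinB !phi_cost.
by rewrite scale0r addr0.
Qed.

Let integrable_slope y n : P.-integrable (C : set B) (slope y n).
Proof.
rewrite (_ : slope y n = fun x =>
  (((harmonic n)^-1)%:E * (cost (b + harmonic n *: y)%R x - cost b x))%E).
  by apply: integrableZl => //; apply: integrableB => //; exact: int_cost.
by apply/funext => x; exact: slopeE.
Qed.

Let integral_slope_ge0 y n : (0 <= \int[P]_(x in (C : set B)) slope y n x)%E.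
Proof.
under eq_integral do rewrite slopeE.
rewrite integralZl //; last by apply: integrableB => //; exact: int_cost.
rewrite mule_ge0 ?lee_fin ?invr_ge0 ?harmonic_ge0 //.
rewrite integralB //; [|exact: int_cost|exact: int_cost].
by rewrite sube_ge0 ?b_min // (integrable_fin_num mC (int_cost b _ mC)).
Qed.

(** The value at x = b is set to 0: this is the true limit of the slopes when r > 1, and b is a null
    point when r = 1. *)
Let lim_slope (y : E) : B -> \bar R :=
  (fun x => (r * cost_grad y x)%:E) \_ (~` [set b]).

Let cvg_slope y : {ae P, forall x : B,
  C x -> slope y n x @[n --> \oo] --> lim_slope y x}.
Proof.
have b_or : {ae P, forall x : B, (x : E) = b -> 1 < r}.
  have [r1|r1] := ltP 1 r; first exact: aeW.
  have r1' : r = 1 by apply/eqP; rewrite eq_le r1 r_ge1.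
  exists [set b]; split; [exact: measurable_borel1|exact: b_null|].
  by move=> x /= nx; apply: contrapT => xb; apply: nx => /xb.
apply: filterS2 b_gateaux b_or => x gx bx _.
rewrite /lim_slope patchE; case: ifPn => [|]; rewrite ?inE ?notin_setE /= => xb.
  have bx0 : b - (x : E) != 0 by rewrite subr_eq0 eq_sym; apply/eqP.
  apply: cvg_EFin; first exact: nearW.
  apply: cvg_secant_harmonic; apply: cvg_dnbhs_at_right.
  rewrite /cost_grad distrC; apply: cvg_secant_norm_powR => //.
  by apply: gx; exact/eqP.
have {xb}xb : (x : E) = b by exact: contrapT.
apply: cvg_EFin; first exact: nearW.
apply: cvg_secant_harmonic.
(* At x = b the slope is explicit, and for t > 0 it is a multiple of the (r - 1)-th power of t,
   which tends to 0 as r > 1. *)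
have -> : secant (phi y x) = (fun t => `|y| `^ r * (`|t| `^ r / t)).
  apply/funext => t; rewrite /secant /phi xb subrr scale0r !add0r normr0.
  by rewrite powR0 ?gt_eqF // subr0 normrZ powRM // mulrA (mulrC (`|y| `^ r)).
rewrite -[X in _ --> X](mulr0 (`|y| `^ r)); apply: cvgMr.
have r1 : 0 < r - 1 by rewrite subr_gt0 bx.
apply: cvg_trans (powR_cvg0 r1); apply: near_eq_cvg.
near=> t; have t0 : 0 < t by near: t; exact: nbhs_right_gt.
by rewrite (gtr0_norm t0) powRB ?powRr1 ?(gt_eqF t0) ?implybT // ltW.
Unshelve. all: by end_near. Qed.

Let dct y : [/\ P.-integrable (C : set B) (lim_slope y)
  & (0 <= \int[P]_(x in (C : set B)) lim_slope y x)%E].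
Proof.
have msl n : measurable_fun (C : set B) (slope y n).
  exact: measurable_int (integrable_slope y n).
have mlim : measurable_fun (C : set B) (lim_slope y).
  apply: (measurable_funS measurableT) => //.
  apply/(measurable_restrictT _ (measurableC measurable_borel1)).
  apply/measurable_EFinP; apply: measurable_funM => //.
  apply/measurable_EFinP; exact: measurable_cost_grad.
(* The three costs are the values of [phi y x] at 1, -1 and 0 that occur in [secant_bound]. *)
pose g (x : B) := (cost (b + y)%R x + cost (b - y)%R x + cost b x)%E.
have ig : P.-integrable (C : set B) g.
  by apply: integrableD => //; [apply: integrableD => //|]; exact: int_cost.
have bnd : {ae P, forall x n, (C : set B) x -> (`|slope y n x| <= g x)%E}.
  apply: aeW => x n _; rewrite /g /slope abse_EFin.
  have cphi : convex_real (phi y x) by exact: convex_norm_powR.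
  have := secant_bound _ _ cphi (harmonic_gt0 n).
  have -> : harmonic n <= 1 :> R by rewrite invf_le1 // ler1n.
  move=> /(_ isT).
  have phi_abs t : `|phi y x t| = phi y x t by rewrite ger0_norm ?powR_ge0.
  rewrite -lee_fin !phi_abs !EFinD !phi_cost.
  by rewrite scale1r scaleN1r scale0r addr0.
have [ilim _ lims] := dominated_convergence mC msl mlim (cvg_slope y) ig bnd.
split => //; apply: (cvge_ge _ lims); apply: nearW => n.
exact: integral_slope_ge0.
Qed.

Lemma integrable_cost_grad y : P.-integrable D (fun x => (cost_grad y x)%:E).
Proof.
have [il _] := dct y.
have mb : measurable (~` [set b] : set B) by exact: measurableC measurable_borel1.
have /(integrable_restrict _ mb mC) := il.
rewrite -setDE => /(integrableZl measurable_cell_setD1 (r^-1)).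
apply: eq_integrable => //; first exact: measurable_cell_setD1.
by move=> x _ /=; rewrite -EFinM mulKf // gt_eqF.
Qed.

Lemma integral_cost_grad_ge0 y : (0 <= \int[P]_(x in D) (cost_grad y x)%:E)%E.
Proof.
have [_] := dct y.
rewrite -integral_mkcondr -setDE.
under eq_integral do rewrite EFinM.
rewrite integralZl //; [|exact: measurable_cell_setD1|exact: integrable_cost_grad].
by rewrite pmule_rge0 // lte_fin.
Qed.

(** The gradient is a.e. odd in the direction, so nonnegativity along both y and - y forces 0. *)
Lemma integral_cost_grad y : (\int[P]_(x in D) (cost_grad y x)%:E = 0)%E.
Proof.
apply/eqP; rewrite eq_le integral_cost_grad_ge0 andbT.
have := integral_cost_grad_ge0 (- y).
rewrite (@ae_eq_integral _ _ _ _ _ (fun x => - (cost_grad y x)%:E)%E); last 4 first.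
- exact: measurable_cell_setD1.
- exact: measurable_cost_grad.
- by apply: measurableT_comp => //; exact: measurable_cost_grad.
- apply: filterS b_gateaux => x gx [_ /eqP xb].
  by rewrite /cost_grad norm_gradN ?mulrN //; exact: gx.
rewrite integralN ?oppe_ge0 //; apply: integrable_add_def.
  exact: measurable_cell_setD1.
exact: integrable_cost_grad.
Qed.

End Stationarity.

(** * Strict convexity and the sign of the gradient *)

Section StrictConvexity.
Context {R : realType} {E : normedModType R}.

(** Rescale to the unit sphere; the common norm is positive, since two zero vectors would
    coincide. *)
Lemma strictly_convex_midpoint (u v : E) : @strictly_convex R E ->
  `|u| = `|v| -> u != v -> `|2^-1 *: (u + v)| < `|u|.
Proof.
move=> sc uv nuv.
have u0 : 0 < `|u|.
  rewrite lt_neqAle normr_ge0 andbT eq_sym; apply: contra_neq nuv => u0.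
  have v0 : `|v| = 0 by rewrite -uv.
  by rewrite (normr0_eq0 u0) (normr0_eq0 v0).
have unit_norm (w : E) : `|w| = `|u| -> `|(`|u|)^-1 *: w| = 1.
  by move=> wu; rewrite normrZ wu normfV normr_id mulVf // gt_eqF.
have := sc (`|u|^-1 *: u) (`|u|^-1 *: v) (unit_norm u erefl) (unit_norm v (esym uv)).
rewrite (inj_eq (scalerI _)) ?invr_eq0 ?gt_eqF // => /(_ nuv).
rewrite -scalerDr scalerA (mulrC 2^-1) -scalerA normrZ normfV normr_id.
by rewrite mulrC ltr_pdivrMr // mul1r.
Qed.

Lemma norm_grad_gt0 (u v : E) : @strictly_convex R E ->
  `|u| = `|v| -> u != v -> norm_gateaux u -> 0 < norm_grad u (u - v).
Proof.
move=> sc uv nuv gu; rewrite -[u - v]opprB norm_gradN // oppr_gt0.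
have /cvg_dnbhs_at_right h := cvg_norm_grad _ (v - u) gu.
(* The derivative towards v is at most the slope at t = 1/2, where the line passes through the
   midpoint of u and v, of strictly smaller norm. *)
apply: (@le_lt_trans _ _ (secant (fun t => `|u + t *: (v - u)|) 2^-1)).
  apply: (cvgr_to_le h); near=> t; apply: secant_nondecreasing => //.
  - exact: convex_norm_line.
  - by near: t; apply: nbhs_right_le; rewrite invr_gt0.
rewrite /secant invrK scale0r addr0 pmulr_llt0 // subr_lt0.
have -> : u + 2^-1 *: (v - u) = 2^-1 *: (u + v).
  rewrite scalerBr scalerDr addrCA addrC; congr (_ + _).
  by rewrite -[X in X - _]scale1r -scalerBl; congr (_ *: _); field.
exact: strictly_convex_midpoint.
Unshelve. all: by end_near. Qed.

End StrictConvexity.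

(** * Voronoi partitions of a finite codebook *)

Section Voronoi.
Context {R : realType} {E : normedModType R} {n : nat} (a : 'I_n -> E).
Local Notation B := (@borelE R E).
Local Notation V := (fun i => vcell (range a) (a i)).
Hypothesis a_inj : injective a.

Lemma vcellP i (x : E) : V i x <-> forall j, `|x - a i| <= `|x - a j|.
Proof. by split => [h j|h _ [j _ <-]]; [exact: h|exact: h]. Qed.

Lemma ocell_vcell i : ocell (range a) (a i) `<=` V i.
Proof.
move=> x Wx; apply/vcellP => j; have [->//|ji] := eqVneq (a j) (a i).
by apply: ltW; exact: Wx.
Qed.

Lemma ocell_disjoint_vcell i j : i != j -> ocell (range a) (a i) `<=` ~` V j.
Proof.
move=> ij x Wx /vcellP/(_ i); rewrite leNgt Wx //.
by rewrite (inj_eq a_inj) eq_sym.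
Qed.

Lemma vcell_cover (x : E) : (0 < n)%N -> exists i, V i x.
Proof.
move=> n0.
have [i _ hi] := arg_minP (P := predT) (fun i => `|x - a i|)
  (erefl : predT (Ordinal n0)).
by exists i; apply/vcellP => j; exact: hi.
Qed.

(** Ties are resolved in favour of the smallest index. *)
Definition first_cell (i : 'I_n) : set E :=
  V i `\` \bigcup_(j in [set j : 'I_n | (j < i)%N]) V j.

(** Partitions are indexed by code points rather than by indices; for injective [a] the union has a
    single term. *)
Definition voronoi_cell (b : E) : set E := \bigcup_(i in [set i | a i = b]) first_cell i.

Lemma voronoi_cellE i : voronoi_cell (a i) = first_cell i.
Proof.
apply/seteqP; split => [x [j /a_inj -> //]|x ?]; by exists i.
Qed.

Lemma measurable_first_cell i : measurable (first_cell i : set B).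
Proof.
apply: measurableD; first exact: measurable_vcell.
apply: fin_bigcup_measurable; first exact: finite_finset.
by move=> j _; exact: measurable_vcell.
Qed.

Lemma ocell_first_cell i : ocell (range a) (a i) `<=` first_cell i.
Proof.
move=> x Wx; split; first exact: ocell_vcell.
by move=> [j /= ji]; apply: ocell_disjoint_vcell Wx; rewrite eq_sym -val_eqE ltn_eqF.
Qed.

Lemma first_cell_vcell i : first_cell i `<=` V i.
Proof. by move=> x []. Qed.

Lemma voronoi_cell_partition : (0 < n)%N -> voronoi_partition (range a) voronoi_cell.
Proof.
move=> n0; split.
- move=> _ [i _ <-]; rewrite voronoi_cellE; split; first exact: measurable_first_cell.
  exact: first_cell_vcell.
- move=> _ _ [i _ <-] [j _ <-] ij; rewrite !voronoi_cellE; apply/seteqP; split => // x.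
  move=> [[Vi ni] [Vj nj]]; have {ij} : i != j by rewrite -(inj_eq a_inj).
  rewrite -val_eqE neq_ltn => /orP[ij|ji]; first by apply: nj; exists i.
  by apply: ni; exists j.
- apply/seteqP; split => // x _; have [i0 Vi0] := vcell_cover x n0.
  have Vi0' : `[< V i0 x >] by exact/asboolP.
  have [i /asboolP Vi imin] := arg_minnP (P := fun i => `[< V i x >]) (fun i => val i) Vi0'.
  exists (a i); rewrite ?voronoi_cellE //; split => // -[j /= ji Vj].
  by have := imin j; rewrite asboolT // => /(_ isT); rewrite leqNgt ji.
Qed.

Lemma card_range_ord : (range a #= `I_n)%card.
Proof.
apply: (card_eq_trans (B := [set: 'I_n])).
  by apply: inj_card_eq => i j _ _; exact: a_inj.
have -> : `I_n = range (@nat_of_ord n).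
  apply/seteqP; split => [k kn|_ [i _ <-]]; last exact: ltn_ord.
  by exists (Ordinal (kn : (k < n)%N)).
by rewrite card_eq_sym; apply: inj_card_eq => i j _ _; exact: val_inj.
Qed.

Lemma range_null (P : probability B R) : (forall i, P [set a i] = 0%E) ->
  P (range a : set B) = 0%E.
Proof.
move=> Pa; rewrite (_ : range a = \bigcup_(i in [set: 'I_n]) [set a i]); last first.
  by apply/seteqP; split => [_ [i _ <-]|x [i _ ->]]; exists i.
apply: measure_negligible.
  by apply: fin_bigcup_measurable => // i _; exact: measurable_borel1.
have : {ae P, forall x : B, forall i, (x : E) <> a i}.
  apply: filter_forall => i; exists [set a i]; split; [exact: measurable_borel1|exact: Pa|].
  by move=> x /= nx; apply: contrapT => xa; apply: nx.
by apply: negligibleS => x [i _ ->] /(_ i).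
Qed.

(** A point in no open cell has two nearest code points, so it lies in one of finitely many null
    intersections of closed cells. *)
Lemma admissible_of_null_boundaries (P : probability B R) : (0 < n)%N ->
  (forall i j, i != j -> P (V i `&` V j) = 0%E) -> admissible P (range a).
Proof.
move=> n0 PV; pose U : set B := \bigcup_(b in range a) ocell (range a) b.
have mU : measurable U.
  apply: open_borel; apply: bigcup_open => b _; apply: open_ocell.
  exact: finite_range_ord.
have aeV : {ae P, forall x : B, forall i j, i != j -> ~ (V i `&` V j) x}.
  apply: filter_forall => i; apply: filter_forall => j.
  have [_|ij] := eqVneq i j; first by apply: aeW => x.
  exists (V i `&` V j); split; [|exact: PV|].
    by apply: measurableI; exact: measurable_vcell.
  by move=> x /= nx; apply: contrapT => Vx; apply: nx.
have PUC : P (~` U) = 0%E.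
  apply: measure_negligible; first exact: measurableC.
  apply: negligibleS aeV => x nUx /= hx; apply: nUx.
  have [i Vi] := vcell_cover x n0; exists (a i) => // _ [j _ <-] ji.
  rewrite ltNge; apply/negP => xj; apply: (hx i j).
    by apply: contra_neq ji => ->.
  split => //; apply/vcellP => k; apply: le_trans xj _.
  by move/vcellP : Vi; exact.
rewrite /admissible -[X in P X]/U -[U]setCK probability_setC ?PUC ?sube0 //.
exact: measurableC.
Qed.

End Voronoi.

(** * Optimality, stationarity and admissibility at a local minimum *)

Theorem theorem2p1 (R : realType) (E : completeNormedModType R)
  (P : probability (@borelE R E) R) (r : R) (n : nat) (a : 'I_n -> E) :
  radon P ->
  0 < r ->
  (\int[P]_x ((`|(x : E)| `^ r)%:E) < +oo)%E ->
  (0 < n)%N ->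
  (exists2 e : R, 0 < e & forall b : 'I_n -> E,
     (forall i, `|b i - a i| < e) -> (distortion P r a <= distortion P r b)%E) ->
  (forall i, non_isolated (mes_support P) (a i)) ->
  (* (a) *)
  (injective a /\
   (1 <= r -> forall (i : 'I_n) (C : set E),
      measurable (C : set (@borelE R E)) ->
      ocell (range a) (a i) `<=` C -> C `<=` vcell (range a) (a i) ->
      (0 < P C)%E /\
      forall y : E,
        (distortion (cond P C) r (fun _ : 'I_1 => a i)
         <= distortion (cond P C) r (fun _ : 'I_1 => y))%E))
  /\
  (* (b) *)
  (1 <= r ->
   (forall b : E, {ae P, forall x : @borelE R E, (x : E) != b -> norm_gateaux (b - x)}) ->
   (r = 1 -> forall i, P [set a i] = 0%E) ->
   stationary P r n (range a) /\
   (@strictly_convex R E -> admissible P (range a))).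
Proof.
move=> _ r_gt0 moment n_gt0 [e e_gt0 a_min] a_supp.
have a_inj := local_min_inj P r r_gt0 moment n a e e_gt0 a_min a_supp.
have opt := cell_global_min P r r_gt0 moment n a e e_gt0 a_min.
split; first split => // r_ge1 i C mC oC Cv.
  split; first exact: cell_pos oC.
  have dist1 (y : E) : distortion (cond P C) r (fun _ : 'I_1 => y) =
      (((fine (P C))^-1)%:E * \int[P]_(x in (C : set (@borelE R E))) cost r y x)%E.
    rewrite -integral_cond //; last 2 first.
    - exact: measurable_cost.
    - by move=> x; exact: cost_ge0.
    rewrite /distortion; congr integral; apply/funext => x.
    by rewrite big_ord_recl big_ord0 min_l // leey.
  move=> y; rewrite !dist1; apply: lee_wpmul2l.
    by rewrite lee_fin invr_ge0 fine_ge0.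
  exact: opt.
move=> r_ge1 gateaux a_null.
(* Stationarity holds on every C between the open and the closed cell; admissibility uses two
   different choices of C. *)
have grad0 i C (mC : measurable (C : set (@borelE R E))) oC Cv y :=
  integral_cost_grad P r r_ge1 moment (a i) C mC
    (fun z => opt i C mC oC Cv z r_ge1) (gateaux (a i)) (fun r1 => a_null r1 i) y.
have igrad i C (mC : measurable (C : set (@borelE R E))) oC Cv y :=
  integrable_cost_grad P r r_ge1 moment (a i) C mC
    (fun z => opt i C mC oC Cv z r_ge1) (gateaux (a i)) (fun r1 => a_null r1 i) y.
split.
  split; first exact: card_range_ord.
    by move=> r1; apply: range_null; exact: a_null.
  exists (voronoi_cell a); split; first exact: voronoi_cell_partition.
  move=> _ [i _ <-]; rewrite voronoi_cellE //.
  have mC := measurable_first_cell a i; have oC := ocell_first_cell a a_inj i.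
  split; first exact: cell_pos oC.
  move=> y; split.
    exact: igrad (first_cell_vcell a i) y.
  exact: grad0 (first_cell_vcell a i) y.
move=> sc; apply: admissible_of_null_boundaries => // i j ij.
set A := _ `&` _.
have mA : measurable (A : set (@borelE R E)) by apply: measurableI; exact: measurable_vcell.
pose V := vcell (range a) (a i).
have mV : measurable (V : set (@borelE R E)) by exact: measurable_vcell.
have mVA : measurable (V `\` A : set (@borelE R E)) by exact: measurableD.
have oV : ocell (range a) (a i) `<=` V by exact: ocell_vcell.
(* The open cell of a_i misses the closed cell of a_j, so V without A is again an allowed choice. *)
have oVA : ocell (range a) (a i) `<=` V `\` A.
  by move=> x Wx; split; [exact: oV|move=> [_]; exact: ocell_disjoint_vcell Wx].
have VAV : V `\` A `<=` V by move=> x [].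
have A_ai x : A x -> x <> a i.
  move=> Ax xi; have /vcellP/(_ i) := Ax.2.
  by rewrite xi subrr normr0 normr_le0 subr_eq0 (inj_eq a_inj) (negbTE ij).
pose y := a i - a j; pose f x := (cost_grad r (a i) y x)%:E.
have VaiE : V `\ a i = (V `\` A) `\ a i `|` A.
  apply/seteqP; split => [x [Vx xi]|x [[[Vx _] xi]//|Ax]].
    by have [Ax|nAx] := pselect (A x); [right|left].
  by split; [exact: Ax.1|exact: A_ai].
have subA : A `<=` V `\ a i by rewrite VaiE; exact: subsetUr.
have mVai : measurable (V `\ a i : set (@borelE R E)).
  by apply: measurableD => //; exact: measurable_borel1.
have mVAai : measurable ((V `\` A) `\ a i : set (@borelE R E)).
  by apply: measurableD => //; exact: measurable_borel1.
(* A is the difference of two sets over which the gradient integrates to 0; a_i is not in A, so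
   puncturing does not affect it. *)
have intA0 : (\int[P]_(x in (A : set (@borelE R E))) f x = 0)%E.
  have := grad0 i V mV oV (@subset_refl _ _) y.
  rewrite VaiE integral_setU //; last 2 first.
  - exact: measurable_cost_grad.
  - by apply/disj_setPS => x [[[_ nA] _] Ax].
  by rewrite (grad0 i _ mVA oVA VAV) add0e.
apply: (@ae_pos_integral_le0_null _ _ _ P A f) => //.
- apply: (integrableS mVai mA subA); exact: (igrad i V mV oV (@subset_refl _ _) y).
- apply: filterS (gateaux (a i)) => x gx Ax.
  have xi : x != a i by apply/eqP; exact: A_ai.
  rewrite lte_fin mulr_gt0 //.
    by rewrite powR_gt0 // normr_gt0 subr_eq0.
  (* On A the vectors a_i - x and a_j - x are distinct and of equal norm. *)
  have -> : y = (a i - x) - (a j - x) by rewrite opprB addrA subrK.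
  apply: norm_grad_gt0 => //; last exact: gx.
    apply/eqP; rewrite eq_le distrC (distrC (a j)).
    by have /vcellP -> := Ax.1; have /vcellP -> := Ax.2.
  by rewrite (inj_eq (addIr _)) (inj_eq a_inj).
by rewrite intA0.
Qed.
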